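(* Let $d,k\ge 1$. For $1\le i\le k$, let $v_i(n)$ be a vector in $\mathbb{R}^d$ whose coordinates are rational functions of $n$ (ratios of polynomials in $n$ with rational coefficients) of size $O(n)$ as $n\to\infty$, and let $V_n=\{v_i(n)\}_{i=1}^k$. Then for $n\gg 0$ the integer hull of $V_n$ is $\mathrm{QIQ}$. That is, there is a positive integer $\pi$ such that for every integer $i$ there are an integer $m_i\ge 0$ and a $d\times m_i$ matrix $M_i(n)$ with entries in $\mathbb{Z}[n]$ such that, for all sufficiently large $n$, the set of vertices of the integer hull of $V_{\pi n+i}$ equals the set of columns of $M_i(n)$. In particular, after passing to a cycle (i.e. restricting to a residue class modulo $\pi$ and reparametrizing), the coordinates of the vertices of the integer hull of $V_n$ are in $\mathbb{Z}[n]$ for $n\gg 0$.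
   Context: Given a finite set of points $P\subset\mathbb{R}^d$, the integer hull of $P$ is the convex hull of the points of $\mathbb{Z}^d$ contained in the convex hull of $P$. The convex hull of $P$ is not assumed to be full dimensional, and the integer hull may be empty (in which case it has no vertices). The parameter $n$ ranges over natural numbers large enough that all the rational functions involved are defined. *)

(* Defs.v *)
From HB Require Import structures.
From mathcomp Require Import all_boot all_order all_algebra.
From mathcomp Require Import all_classical all_reals all_analysis.

Set Implicit Arguments.
Unset Strict Implicit.
Unset Printing Implicit Defensive.

Import Order.TTheory GRing.Theory Num.Theory.
Import numFieldNormedType.Exports.

Local Open Scope classical_set_scope.
Local Open Scope ring_scope.

(* The numerator and denominator are those of the representative chosen by
   [repr], which need not be reduced: by [fraceval_frac] the choice only matters
   at the finitely many roots of that denominator. *)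
Definition fraceval (f : {fraction {poly rat}}) (x : rat) : rat :=
  (repr f).1.[x] / (repr f).2.[x].

Lemma frac_pi (p q : {poly rat}) : q != 0 ->
  tofrac p / tofrac q = (\pi_({fraction {poly rat}}) (Ratio p q))%qT.
Proof.
move=> q0; apply: (mulIf (x := tofrac q)); first by rewrite tofrac_eq0.
rewrite divfK ?tofrac_eq0 //; unlock tofrac; rewrite -[RHS]FracField.pi_mul.
apply/eqmodP; rewrite /= FracField.equivfE /FracField.mulf.
by rewrite !numden_Ratio ?mulf_neq0 ?numden_Ratio ?oner_neq0 // !mulr1 mul1r
  mulrC.
Qed.

Lemma fraceval_frac (p q : {poly rat}) (x : rat) :
  q.[x] != 0 -> (repr (tofrac p / tofrac q)).2.[x] != 0 ->
  fraceval (tofrac p / tofrac q) x = p.[x] / q.[x].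
Proof.
move=> qx0 dx0.
have q0 : q != 0 by apply: contraNneq qx0 => ->; rewrite horner0.
apply/eqP; rewrite /fraceval eqr_div // -!hornerM.
rewrite frac_pi //; have := FracField.equivf_r (Ratio p q).
by rewrite !numden_Ratio // => ->; rewrite mulrC.
Qed.

Section IntegerHull.
Variables (R : realType) (d : nat).
Implicit Types P K : set 'cV[R]_d.

Definition convex_hull P : set 'cV[R]_d :=
  smallest (@convex_set R 'cV[R]_d) P.

Definition integer_points : set 'cV[R]_d :=
  [set x | x \is a mxOver Num.int].

Definition integer_hull P : set 'cV[R]_d :=
  convex_hull (integer_points `&` convex_hull P).

(* The vertices of a polytope are its extreme points. *)
Definition vertices K : set 'cV[R]_d :=
  [set x | K x /\ forall (y z : 'cV[R]_d) (t : R), K y -> K z ->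
     0 < t < 1 -> x = t *: y + (1 - t) *: z -> y = x /\ z = x].

Definition columns_at m (M : 'M[{poly int}]_(d, m)) (n : nat) :
    set 'cV[R]_d :=
  [set x | exists j : 'I_m, x = col j (map_mx (fun p => p.[n%:Z]%:~R) M)].

(* The index is in [int] because the residue i may be negative; per * n + i is
   nonnegative for large n, so only the values of H at large naturals matter. *)
Definition QIQ (H : int -> set 'cV[R]_d) : Prop :=
  exists2 per : nat, (0 < per)%N & forall i : int,
    exists (m : nat) (M : 'M[{poly int}]_(d, m)),
      \forall n \near \oo,
        vertices (H (per%:Z * n%:Z + i)) = columns_at M n.

Definition ratvec (v : 'cV[{fraction {poly rat}}]_d) (n : int) : 'cV[R]_d :=
  map_mx (fun f => ratr (fraceval f n%:~R)) v.

End IntegerHull.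

(* Main.v *)
(* Write P_n for the hull of V_n. Fourier-Motzkin elimination of the barycentric
   coordinates describes P_n, for n >> 0, by finitely many inequalities
   c(n) + sum_i A_i(n) x_i >= 0 with c, A_i in Z[n]. As V_n has size O(n), only
   integral x with |x| <= K n matter, and for these the sign of such an
   expression is determined by the signs of finitely many integral forms
   B x + alpha n + beta, by induction on the degree in n. If the forms that are
   small at a vertex x of the integer hull had a nonzero common integral kernel
   vector z, then x + z and x - z would also lie in P_n; hence x solves a linear
   system of full rank and belongs to a finite list of points a n + b with
   rational a, b. On a residue class modulo a common denominator of the a's,
   integrality of a n + b is constant, and membership of such points in P_n, or
   in the hull of other such points, is eventually constant, again by
   Fourier-Motzkin. *)

Require Import Defs.
From HB Require Import structures.
From mathcomp Require Import all_boot all_order all_algebra.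
From mathcomp Require Import all_classical all_reals all_analysis.
From mathcomp Require Import ring lra zify.
From mathcomp Require polyrcf.

Set Implicit Arguments.
Unset Strict Implicit.
Unset Printing Implicit Defensive.

Import Order.TTheory GRing.Theory Num.Theory.
Import numFieldNormedType.Exports.

Local Open Scope classical_set_scope.
Local Open Scope ring_scope.

(** * Convex hulls and their vertices *)

Section ConvexHull.
Variables (R : realType) (d : nat).
Implicit Types (A B : set 'cV[R]_d) (x y : 'cV[R]_d).

Lemma convex_setP A :
  convex_set (A : set (convex_lmodType 'cV[R]_d)) <->
  forall x y t, A x -> A y -> 0 < t < 1 -> A (t *: x + (1 - t) *: y).
Proof.
split=> [cA x y t Ax Ay /andP[t0 t1]|cA].
  have := cA x y (Itv01 (ltW t0) (ltW t1)); rewrite !inE; exact.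
apply/convex_setW => x y; rewrite !inE => Ax Ay k k0 k1; rewrite inE.
by apply: cA => //; rewrite k0.
Qed.

Lemma convex_convex_hull A :
  convex_set (convex_hull A : set (convex_lmodType 'cV[R]_d)).
Proof.
apply/convex_setP => x y t Ax Ay t01 B BA; have /convex_setP cB := BA.1.
by apply: cB => //; [exact: Ax|exact: Ay].
Qed.

Lemma convex_hull_sub A B :
  (forall x y t, B x -> B y -> 0 < t < 1 -> B (t *: x + (1 - t) *: y)) ->
  A `<=` B -> convex_hull A `<=` B.
Proof. by move=> /convex_setP cB; exact: smallest_sub. Qed.

Lemma sub_convex_hull A : A `<=` convex_hull A.
Proof. exact: sub_gen_smallest. Qed.

Lemma convex_hull_le A B : A `<=` convex_hull B -> convex_hull A `<=` convex_hull B.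
Proof. exact: smallest_sub (@convex_convex_hull B). Qed.

Lemma convex_hullD A x y t : convex_hull A x -> convex_hull A y -> 0 < t < 1 ->
  convex_hull A (t *: x + (1 - t) *: y).
Proof. by have /convex_setP := @convex_convex_hull A; exact. Qed.

(** The weights are not normalised, so that the induction on [s] applies to tails of any total
    weight; [a0] is the point returned when all weights vanish. *)
Lemma convex_hull_comb A (I : Type) (s : seq I) (u : I -> R)
    (f : I -> 'cV[R]_d) a0 :
    convex_hull A a0 -> (forall i, 0 <= u i) -> (forall i, A (f i)) ->
  exists2 a, convex_hull A a &
    \sum_(i <- s) u i *: f i = (\sum_(i <- s) u i) *: a.
Proof.
move=> Aa0 u0 Af; elim: s => [|i s [a Aa IH]].
  by exists a0 => //; rewrite !big_nil scale0r.
rewrite !big_cons IH; set S := \sum_(j <- s) u j.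
have S0 : 0 <= S by apply: sumr_ge0.
have Afi := sub_convex_hull (Af i).
have [->|ui] := eqVneq (u i) 0; first by exists a => //; rewrite scale0r !add0r.
have [->|Sn] := eqVneq S 0; first by exists (f i) => //; rewrite scale0r !addr0.
have {}ui : 0 < u i by rewrite lt_def ui u0.
have {Sn}S0 : 0 < S by rewrite lt_def Sn S0.
exists ((u i / (u i + S)) *: f i + (1 - u i / (u i + S)) *: a).
  apply: convex_hullD => //.
  by rewrite divr_gt0 ?addr_gt0 //= ltr_pdivrMr ?addr_gt0 // mul1r ltrDl.
rewrite scalerDr !scalerA; congr (_ *: _ + _ *: _); field;
  by rewrite gt_eqF // addr_gt0.
Qed.

Lemma convex_hull_rangeP (J : finType) (f : J -> 'cV[R]_d) x :
  convex_hull (range f) x <->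
  exists u : J -> R,
    [/\ forall j, 0 <= u j, \sum_j u j = 1 & x = \sum_j u j *: f j].
Proof.
split=> [|[u [u0 u1 ->]]].
  apply: (@convex_hull_sub _
    [set x | exists u : J -> R, [/\ forall j, 0 <= u j, \sum_j u j = 1
       & x = \sum_j u j *: f j]]) => [{}x y t [u [u0 u1 ->]] [w [w0 w1 ->]]|].
    move=> /andP[t0 t1]; exists (fun j => t * u j + (1 - t) * w j); split.
    - by move=> j; rewrite addr_ge0 // mulr_ge0 ?u0 ?w0 ?subr_ge0 // ltW.
    - by rewrite big_split /= -!mulr_sumr u1 w1; ring.
    rewrite !scaler_sumr -big_split /=; apply: eq_bigr => j _.
    by rewrite !scalerA -scalerDl.
  move=> _ [j _ <-]; exists (fun i => (i == j)%:R); split.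
  - by move=> i; rewrite ler0n.
  - by rewrite (bigD1 j) //= eqxx big1 ?addr0 // => i /negbTE ->.
  rewrite (bigD1 j) //= eqxx scale1r big1 ?addr0 // => i /negbTE ->.
  by rewrite scale0r.
have [j _|J0] := pickP (@predT J); last first.
  by move: u1; rewrite big_pred0 // => /esym/eqP; rewrite oner_eq0.
have [] := @convex_hull_comb (range f) _ (index_enum J) u f (f j) _ u0 _.
- by apply: sub_convex_hull; exists j.
- by move=> i; exists i.
by move=> a Aa ->; rewrite u1 scale1r.
Qed.

Lemma convex_hull_box A (K : R) : (forall x, A x -> forall i, `|x i 0| <= K) ->
  forall x, convex_hull A x -> forall i, `|x i 0| <= K.
Proof.
move=> AK; apply: convex_hull_sub => // x y t xK yK /andP[t0 t1] i.
rewrite !mxE; move: (xK i) (yK i); rewrite !ler_norml.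
move=> /andP[? ?] /andP[? ?]; apply/andP; split; nra.
Qed.

(** A hull from which an extreme point is removed is still convex, and here it contains [B]. *)
Lemma notin_convex_hull A B x : vertices (convex_hull A) x ->
  B `<=` convex_hull A -> ~ B x -> ~ convex_hull B x.
Proof.
move=> [_ vx] BA Bx Cx.
suff BAx : convex_hull B `<=` convex_hull A `\ x by have [_] := BAx x Cx; exact.
apply: convex_hull_sub => [z w t [Az zx] [Aw wx] t01|z Bz].
  split; first exact: convex_hullD.
  by move=> /esym/(vx _ _ _ Az Aw t01)[/zx].
by split; [exact: BA|move=> zx; apply: Bx; rewrite -zx].
Qed.

Lemma vertices_sub A : vertices (convex_hull A) `<=` A.
Proof.
move=> x vx; apply: contrapT => Ax.
by apply: (notin_convex_hull vx (@sub_convex_hull A) Ax); exact: vx.1.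
Qed.

Lemma vertices_convex_hullP A x :
  vertices (convex_hull A) x <-> A x /\ ~ convex_hull (A `\ x) x.
Proof.
split=> [vx|[Ax Cx]].
  split; first exact: vertices_sub.
  apply: (notin_convex_hull vx) => [y [Ay _]|[_]]; last exact.
  exact: sub_convex_hull.
(* The point $x$ and all $x + s(a - x)$, with $s > 0$ and $a$ in the hull of $A$ without $x$, form a
   convex set containing $A$. If $x$ lies strictly between two points of this form that are not both
   $x$, solving for $x$ puts it in the hull of the points $a$ involved, contrary to [Cx]. *)
have star y : convex_hull A y -> y = x \/ exists s a,
    [/\ 0 < s, convex_hull (A `\ x) a & y = x + s *: (a - x)].
  move: y; apply: convex_hull_sub => [y z t|y Ay]; last first.
    have [->|yx] := pselect (y = x); first by left.
    right; exists 1, y; split=> //; last by rewrite scale1r addrC subrK.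
    by apply: sub_convex_hull; split.
  move=> yP zP /andP[t0 t1]; have t1' : 0 < 1 - t by rewrite subr_gt0.
  case: yP zP => [->|[s [a [s0 Ca ->]]]] [->|[s' [a' [s'0 Ca' ->]]]].
  - by left; rewrite -scalerDl addrC subrK scale1r.
  - right; exists ((1 - t) * s'), a'; split=> //; first exact: mulr_gt0.
    by apply/colP => i; rewrite !mxE; ring.
  - right; exists (t * s), a; split=> //; first exact: mulr_gt0.
    by apply/colP => i; rewrite !mxE; ring.
  have ts := mulr_gt0 t0 s0; have ts' := mulr_gt0 t1' s'0.
  right; exists (t * s + (1 - t) * s'),
    ((t * s / (t * s + (1 - t) * s')) *: a +
     (1 - t * s / (t * s + (1 - t) * s')) *: a'); split.
  - exact: addr_gt0.
  - apply: convex_hullD => //.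
    by rewrite divr_gt0 ?addr_gt0 //= ltr_pdivrMr ?addr_gt0 // mul1r ltrDl.
  by apply/colP => i; rewrite !mxE; field; rewrite gt_eqF // addr_gt0.
split=> [|y z t Cy Cz /andP[t0 t1] xE]; first exact: sub_convex_hull.
have t1' : 0 < 1 - t by rewrite subr_gt0.
have [[yx|[s [a [s0 Ca yE]]]] [zx|[s' [a' [s'0 Ca' zE]]]]] :=
  (star y Cy, star z Cz).
- by [].
- suff xa : x = a' by case: Cx; rewrite {2}xa.
  apply/colP => i.
  have /(congr1 (fun w : 'cV_d => w i 0)) := xE; rewrite zE yx !mxE => e.
  apply/eqP; rewrite eq_sym -subr_eq0 -(mulrI_eq0 _ (lregP (lt0r_neq0 t1'))).
  rewrite -(mulrI_eq0 _ (lregP (lt0r_neq0 s'0))); apply/eqP.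
  by move: e; lra.
- suff xa : x = a by case: Cx; rewrite {2}xa.
  apply/colP => i.
  have /(congr1 (fun w : 'cV_d => w i 0)) := xE; rewrite yE zx !mxE => e.
  apply/eqP; rewrite eq_sym -subr_eq0 -(mulrI_eq0 _ (lregP (lt0r_neq0 t0))).
  rewrite -(mulrI_eq0 _ (lregP (lt0r_neq0 s0))); apply/eqP.
  by move: e; lra.
have ts := mulr_gt0 t0 s0; have ts' := mulr_gt0 t1' s'0.
suff xa : x = (t * s / (t * s + (1 - t) * s')) *: a +
     (1 - t * s / (t * s + (1 - t) * s')) *: a'.
  case: Cx; rewrite {2}xa; apply: convex_hullD => //.
  by rewrite divr_gt0 ?addr_gt0 //= ltr_pdivrMr ?addr_gt0 // mul1r ltrDl.
apply/colP => i.
have /(congr1 (fun w : 'cV_d => w i 0)) := xE; rewrite yE zE !mxE => e.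
have S0 : t * s + (1 - t) * s' != 0 by rewrite gt_eqF // addr_gt0.
apply: (mulfI S0).
transitivity (t * s * a i 0 + (1 - t) * s' * a' i 0); last by field.
by move: e; lra.
Qed.

(** Points lying in the hull of the others are discarded one at a time; when none is left to
    discard, every remaining point is a vertex by [vertices_convex_hullP]. *)
Lemma krein_milman_seq (s : seq 'cV[R]_d) :
  [set` s] `<=` convex_hull (vertices (convex_hull [set` s])).
Proof.
have [n] := ubnP (size s); elim: n s => // n IH s; rewrite ltnS => sn.
have [[x [xs Cx]]|nex] :=
    pselect (exists x, x \in s /\ convex_hull ([set` s] `\ x) x).
  set s' := [seq y <- s | y != x].
  have s'E : [set` s] `\ x = [set` s'].
    by apply/seteqP; split=> y /=; rewrite mem_filter;
      [move=> [-> /eqP ->]|move=> /andP[/eqP ? ->]].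
  rewrite s'E in Cx.
  have ss' : [set` s] `<=` convex_hull [set` s'].
    move=> y ys; have [->//|yx] := eqVneq y x; apply: sub_convex_hull => /=.
    by rewrite mem_filter yx.
  have -> : convex_hull [set` s] = convex_hull [set` s'].
    apply/seteqP; split; first exact: convex_hull_le.
    apply: convex_hull_le => y /=; rewrite mem_filter => /andP[_ ys].
    exact: sub_convex_hull.
  apply: (subset_trans ss'); apply: convex_hull_le; apply: IH.
  apply: leq_trans sn; rewrite size_filter -(count_predC (pred1 x) s).
  rewrite -[X in (X < _)%N]add0n ltn_add2r lt0n -lt0n -has_count.
  by apply/hasP; exists x => /=.
move=> x xs; apply: sub_convex_hull; apply/vertices_convex_hullP; split=> //.
by move=> Cx; apply: nex; exists x.
Qed.

End ConvexHull.

Lemma near_all_seq (T : Type) (F : set_system T) (I : eqType) (s : seq I)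
    (P : I -> T -> Prop) : Filter F ->
  (forall i, i \in s -> \forall x \near F, P i x) ->
  \forall x \near F, forall i, i \in s -> P i x.
Proof.
move=> FF; elim: s => [|i s IH] H; first exact: nearW.
have Hi := H i (mem_head _ _).
have {}IH := IH (fun j js => H j (mem_behead (s := i :: s) js)).
by apply: filterS2 Hi IH => x Hx IHx j; rewrite in_cons => /orP[/eqP ->|/IHx].
Qed.

(** * Fourier-Motzkin elimination with coefficients in Z[n] *)

Section RationalFamilies.
Variable R : realType.

Definition peval (p : {poly int}) (n : nat) : R := p.[n%:Z]%:~R.

Lemma pevalE p n : peval p n = (map_poly intr p).[n%:R].
Proof. by rewrite -[n%:R]/(n%:~R) horner_map. Qed.

Lemma pevalD p q n : peval (p + q) n = peval p n + peval q n.
Proof. by rewrite /peval hornerD rmorphD. Qed.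

Lemma pevalN p n : peval (- p) n = - peval p n.
Proof. by rewrite /peval hornerN rmorphN. Qed.

Lemma pevalB p q n : peval (p - q) n = peval p n - peval q n.
Proof. by rewrite pevalD pevalN. Qed.

Lemma pevalM p q n : peval (p * q) n = peval p n * peval q n.
Proof. by rewrite /peval hornerM rmorphM. Qed.

Lemma peval0 n : peval 0 n = 0.
Proof. by rewrite /peval horner0. Qed.

Lemma pevalC (c : int) n : peval c%:P n = c%:~R.
Proof. by rewrite /peval hornerC. Qed.

Lemma peval1 n : peval 1 n = 1.
Proof. by rewrite pevalC. Qed.

Lemma peval_sum (I : Type) (s : seq I) (P : pred I) (F : I -> {poly int}) n :
  peval (\sum_(i <- s | P i) F i) n = \sum_(i <- s | P i) peval (F i) n.
Proof. by rewrite /peval horner_sum rmorph_sum. Qed.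

Lemma peval_prod (I : Type) (s : seq I) (P : pred I) (F : I -> {poly int}) n :
  peval (\prod_(i <- s | P i) F i) n = \prod_(i <- s | P i) peval (F i) n.
Proof. by rewrite /peval horner_prod rmorph_prod. Qed.

Lemma near_peval_gt0 p : 0 < lead_coef p -> \forall n \near \oo, 0 < peval p n.
Proof.
move=> p0; have [|b bP] := @polyrcf.poly_pinfty_gt_lc R (map_poly intr p).
  by rewrite lead_coef_map_inj ?ltr0z //; exact: intr_inj.
apply: filterS (nbhs_infty_ger b) => n /= /bP; rewrite pevalE.
by apply: lt_le_trans; rewrite lead_coef_map_inj ?ltr0z //; exact: intr_inj.
Qed.

Lemma near_peval_lt0 p : lead_coef p < 0 -> \forall n \near \oo, peval p n < 0.
Proof.
move=> p0; have := @near_peval_gt0 (- p).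
rewrite lead_coefN oppr_gt0 => /(_ p0); apply: filterS => n.
by rewrite pevalN oppr_gt0.
Qed.

Lemma near_peval_neq0 p : p != 0 -> \forall n \near \oo, peval p n != 0.
Proof.
rewrite -lead_coef_eq0; case: ltgtP => // p0 _.
- by apply: filterS (near_peval_lt0 p0) => n /lt_eqF ->.
- by apply: filterS (near_peval_gt0 p0) => n /gt_eqF ->.
Qed.

Definition ratl (g : nat -> R) := exists A B : {poly int},
  B != 0 /\ \forall n \near \oo, g n = peval A n / peval B n.

(** The product of the squared denominators is positive for large $n$, so inequalities can be
    multiplied by [D] without changing direction. *)
Lemma common_denominator (T : finType) (g : T -> nat -> R) :
    (forall t, ratl (g t)) ->
  exists (D : {poly int}) (A : T -> {poly int}), \forall n \near \oo,
    0 < peval D n /\ forall t, g t n = peval (A t) n / peval D n.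
Proof.
move=> /choice[A /choice[B AB]].
exists (\prod_t B t ^+ 2), (fun t => A t * B t * \prod_(s | s != t) B s ^+ 2).
have gE : \forall n \near \oo, forall t, g t n = peval (A t) n / peval (B t) n.
  by apply: filter_forall => t; case: (AB t).
have B0 : \forall n \near \oo, forall t, peval (B t) n != 0.
  by apply: filter_forall => t; apply: near_peval_neq0; case: (AB t).
apply: filterS2 gE B0 => n gE B0; rewrite peval_prod; split=> [|t].
  by apply: prodr_gt0 => t _; rewrite expr2 pevalM -expr2 exprn_even_gt0 //= B0.
rewrite gE [X in _ = _ / X](bigD1 t) //= !pevalM peval_prod.
set P := \prod_(s | _) _.
have P0 : P != 0 by apply/prodf_neq0 => s _; rewrite expr2 pevalM mulf_neq0 ?B0.
by field; rewrite P0; exact: B0.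
Qed.

Section FourierMotzkin.
Variable T : finType.
Local Notation linform := {ffun T -> {poly int}}.
Implicit Types (c : linform) (u : T -> R).

Definition lineval c n u : R := \sum_t peval (c t) n * u t.

Lemma ler_between (lo hi : seq R) :
  (forall a b, a \in lo -> b \in hi -> a <= b) ->
  exists x, (forall a, a \in lo -> a <= x) /\ (forall b, b \in hi -> x <= b).
Proof.
elim: lo => [_|a lo IH H].
  elim: hi => [|b hi [x [_ xhi]]]; first by exists 0.
  exists (Num.min x b); split=> // b'; rewrite in_cons => /orP[/eqP->|/xhi].
    by rewrite ge_min lexx orbT.
  by apply: le_trans; rewrite ge_min lexx.
have [|x [xlo xhi]] := IH.
  by move=> a' b a'lo; apply: H; rewrite in_cons a'lo orbT.
exists (Num.max x a); split=> [a'|b bhi].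
  rewrite in_cons => /orP[/eqP->|/xlo]; first by rewrite le_max lexx orbT.
  by move=> /le_trans; apply; rewrite le_max lexx.
by rewrite ge_max xhi //= H // mem_head.
Qed.

(** The coefficient at [t] cancels; where [c t] is positive and [c' t] negative, this is a positive
    combination of [c] and [c']. *)
Definition fm_comb (t : T) c c' : linform :=
  [ffun s => c t * c' s - c' t * c s].

Lemma lineval_comb t c c' n u : lineval (fm_comb t c c') n u =
  peval (c t) n * lineval c' n u - peval (c' t) n * lineval c n u.
Proof.
rewrite /lineval !mulr_sumr -sumrB; apply: eq_bigr => s _.
by rewrite ffunE pevalB !pevalM; ring.
Qed.

Lemma linevalD1 t c n u :
  lineval c n u = peval (c t) n * u t + \sum_(s | s != t) peval (c s) n * u s.
Proof. by rewrite /lineval (bigD1 t). Qed.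

(** For large $n$ the coefficient of $u_t$ in each form has the sign of its leading coefficient, so
    a single splitting into lower bounds [Lp], upper bounds [Ln] and forms [L0] free of $u_t$ serves
    all these $n$. A value of $u_t$ between the bounds exists exactly when each lower bound is at
    most each upper bound, which the forms [fm_comb] express. *)
Lemma fourier_motzkin1 (L : seq linform) (t : T) :
  exists L' : seq linform, \forall n \near \oo, forall u,
    (exists u', (forall s, s != t -> u' s = u s) /\
       forall c, c \in L -> 0 <= lineval c n u') <->
    (forall c, c \in L' -> 0 <= lineval c n u).
Proof.
pose L0 := [seq c : linform <- L | c t == 0].
pose Lp := [seq c : linform <- L | 0 < lead_coef (c t)].
pose Ln := [seq c : linform <- L | lead_coef (c t) < 0].
exists (L0 ++ [seq fm_comb t c c' | c <- Lp, c' <- Ln]).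
have sp : \forall n \near \oo, forall c, c \in Lp -> 0 < peval (c t) n.
  apply: near_all_seq => c; rewrite mem_filter => /andP[c0 _].
  exact: near_peval_gt0.
have sn : \forall n \near \oo, forall c, c \in Ln -> peval (c t) n < 0.
  apply: near_all_seq => c; rewrite mem_filter => /andP[c0 _].
  exact: near_peval_lt0.
apply: filterS2 sp sn => n sp sn u.
pose r c := \sum_(s | s != t) peval (c s) n * u s.
have rE u' c : (forall s, s != t -> u' s = u s) ->
    lineval c n u' = peval (c t) n * u' t + r c.
  move=> uu; rewrite (linevalD1 t); congr (_ + _).
  by apply: eq_bigr => s /uu ->.
have sub X c : c \in [seq c : linform <- L | X c] -> c \in L.
  by rewrite mem_filter => /andP[].
split=> [[u' [uu Lu]] c|H].
  have LE c' : c' \in L -> 0 <= peval (c' t) n * u' t + r c'.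
    by move=> /Lu; rewrite rE.
  rewrite mem_cat => /orP[|/allpairsP[[a b] /= [aL bL ->]]].
    rewrite mem_filter => /andP[/eqP c0 /LE].
    by rewrite (linevalD1 t) c0 peval0 !mul0r.
  have ap := sp _ aL; have bn := sn _ bL.
  rewrite lineval_comb !(linevalD1 t) -/(r a) -/(r b).
  have := LE _ (sub _ _ aL); have := LE _ (sub _ _ bL).
  set A := peval (a t) n in ap *; set B := peval (b t) n in bn *.
  by move=> h1 h2; nra.
have [|x [xlo xhi]] := @ler_between
    [seq - r c / peval (c t) n | c <- Lp] [seq - r c / peval (c t) n | c <- Ln].
  move=> _ _ /mapP[a aL ->] /mapP[b bL ->].
  have ap := sp _ aL; have bn := sn _ bL.
  have := H (fm_comb t a b); rewrite mem_cat allpairs_f // orbT => /(_ isT).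
  rewrite lineval_comb !(linevalD1 t) -/(r a) -/(r b).
  rewrite ler_pdivrMr // mulrAC ler_ndivlMr //.
  set A := peval (a t) n in ap *; set B := peval (b t) n in bn *; lra.
exists (fun s => if s == t then x else u s); split=> [s /negbTE ->//|c cL].
rewrite rE => [|s /negbTE -> //]; rewrite eqxx.
have [c0|c0|c0] := ltgtP (lead_coef (c t)) 0.
- have cn : c \in Ln by rewrite mem_filter c0.
  have := xhi _ (map_f _ cn); rewrite ler_ndivlMr ?sn // => h.
  by rewrite -lerBlDr sub0r mulrC.
- have cp : c \in Lp by rewrite mem_filter c0.
  have := xlo _ (map_f _ cp); rewrite ler_pdivrMr ?sp // => h.
  by rewrite -lerBlDr sub0r mulrC.
have ct : c t == 0 by rewrite -lead_coef_eq0 c0.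
have /H : c \in L0 ++ [seq fm_comb t c c' | c <- Lp, c' <- Ln].
  by rewrite mem_cat mem_filter ct cL.
by rewrite (linevalD1 t) (eqP ct) peval0 !mul0r.
Qed.

Lemma fourier_motzkin (L : seq linform) (s : seq T) :
  exists L' : seq linform, \forall n \near \oo, forall u,
    (exists u', (forall t, t \notin s -> u' t = u t) /\
       forall c, c \in L -> 0 <= lineval c n u') <->
    (forall c, c \in L' -> 0 <= lineval c n u).
Proof.
elim: s => [|t s [L1 IH]].
  exists L; apply: nearW => n u; split=> [[u' [uu H]] c /H|H]; last by exists u.
  by rewrite (_ : u' = u) //; apply/funext => t; rewrite uu.
have [L' HL'] := fourier_motzkin1 L1 t; exists L'.
apply: filterS2 IH HL' => n IH HL' u; rewrite -HL'; split.
  move=> [u' [uu H]]; exists (fun r => if r == t then u' r else u r).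
  split=> [r /negbTE -> //|]; apply/IH; exists u'; split=> // r rs.
  by case: eqVneq => // rt; rewrite uu // in_cons negb_or rt.
move=> [u1 [uu1 /IH[u' [uu' H]]]]; exists u'; split=> // r.
by rewrite in_cons negb_or => /andP[rt rs]; rewrite uu' ?uu1.
Qed.

End FourierMotzkin.

(** * Half-space description of the hull of a rational family *)

Section Hull.
Variable d : nat.

Definition aff := ({poly int} * {ffun 'I_d -> {poly int}})%type.

Definition affeval (p : aff) (n : nat) (x : 'cV[R]_d) : R :=
  peval p.1 n + \sum_i peval (p.2 i) n * x i 0.

Variables (J : finType) (F : J -> nat -> 'cV[R]_d).
Hypothesis ratF : forall j i, ratl (fun n => F j n i 0).

Lemma convex_hull_halfspaces : exists L : seq aff,
  \forall n \near \oo, forall x,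
    convex_hull (range (F^~ n)) x <-> forall p, p \in L -> 0 <= affeval p n x.
Proof.
have [D [A DA]] := @common_denominator (J * 'I_d)%type
  (fun ji n => F ji.1 n ji.2 0) (fun ji => ratF ji.1 ji.2).
(* The unknowns: the constant 1, the coordinates of x, the barycentric
   coordinates to be eliminated. *)
pose T : finType := ('I_1 + 'I_d + J)%type.
pose linform := {ffun T -> {poly int}}.
have sumT (f : T -> R) : \sum_t f t =
    f (inl (inl 0)) + \sum_i f (inl (inr i)) + \sum_j f (inr j).
  by rewrite big_sumType /= big_sumType /= big_ord1.
(* The constraints: barycentric coordinates are nonnegative ([c1]), sum to the constant ([c2]), and
   represent the coordinate $x_i$ after clearing denominators ([c3]). An equation enters as a form
   together with its opposite. *)
pose c1 j : linform := [ffun t => if t == inr j then 1 else 0].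
pose c2 : linform :=
  [ffun t => match t with inl (inl _) => -1 | inl (inr _) => 0 | inr _ => 1 end].
pose c3 i : linform :=
  [ffun t => match t with inl (inl _) => 0
     | inl (inr i') => if i' == i then D else 0 | inr j => - A (j, i) end].
pose opp (c : linform) : linform :=
  [ffun t => - c t].
pose L := [seq c1 j | j <- enum J] ++ [:: c2; opp c2] ++
  [seq c3 i | i <- enum 'I_d] ++ [seq opp (c3 i) | i <- enum 'I_d].
have [L' HL'] := fourier_motzkin L [seq inr j | j <- enum J].
exists [seq (c (inl (inl 0)), [ffun i => c (inl (inr i))]) | c : linform <- L'].
apply: filterS2 DA HL' => n [D0 FA] HL' x.
(* The values at the eliminated unknowns are arbitrary; taking 0 turns each remaining form into an
   affine form in $x$. *)
pose u (t : T) : R := match t with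
  | inl (inl _) => 1 | inl (inr i) => x i 0 | inr j => 0 end.
have uE (c : linform) : lineval c n u =
    affeval (c (inl (inl 0)), [ffun i => c (inl (inr i))]) n x.
  rewrite /lineval sumT /affeval /= mulr1 [X in _ + X]big1 => [|j _].
    by rewrite addr0; congr (_ + _); apply: eq_bigr => i _; rewrite ffunE.
  by rewrite mulr0.
have -> : (forall p, p \in [seq (c (inl (inl 0)), [ffun i => c (inl (inr i))])
    | c : linform <- L'] -> 0 <= affeval p n x) <->
    forall c, c \in L' -> 0 <= lineval c n u.
  split=> [H c cL|H _ /mapP[c cL ->]]; last by rewrite -uE H.
  by rewrite uE; apply: H; apply/mapP; exists c.
rewrite -HL' convex_hull_rangeP.
have oppE c w : lineval (opp c) n w = - lineval c n w.
  rewrite /lineval -sumrN; apply: eq_bigr => t _.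
  by rewrite ffunE pevalN mulNr.
have c1E j w : lineval (c1 j) n w = w (inr j).
  rewrite (linevalD1 (inr j)) big1 ?addr0 => [|t /negbTE tj].
    by rewrite ffunE eqxx peval1 mul1r.
  by rewrite ffunE tj peval0 mul0r.
have c2E w : lineval c2 n w = \sum_j w (inr j) - w (inl (inl 0)).
  rewrite /lineval sumT ffunE pevalN peval1 mulN1r [X in _ + X + _]big1.
    rewrite addr0 addrC; congr (_ - _); apply: eq_bigr => j _.
    by rewrite ffunE peval1 mul1r.
  by move=> i _; rewrite ffunE peval0 mul0r.
have c3E i w : lineval (c3 i) n w =
    peval D n * (w (inl (inr i)) - \sum_j w (inr j) * F j n i 0).
  rewrite /lineval sumT ffunE peval0 mul0r add0r (bigD1 i) //= big1.
    rewrite ffunE eqxx addr0 mulrBr; congr (_ + _).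
    rewrite mulr_sumr -sumrN; apply: eq_bigr => j _.
    rewrite ffunE pevalN (FA (j, i)) /=; field; exact: lt0r_neq0.
  by move=> i' /negbTE ii'; rewrite ffunE ii' peval0 mul0r.
split=> [[l [l0 l1 xE]]|[w [wu H]]].
  pose w (t : T) : R := if t is inr j then l j else u t.
  exists w; split=> [[t//|j]|c].
    by rewrite mem_map ?mem_enum // => ? ? [].
  have c2w : lineval c2 n w = 0 by rewrite c2E l1 subrr.
  have c3w i : lineval (c3 i) n w = 0.
    rewrite c3E /= xE summxE (eq_bigr (fun j => l j * F j n i 0)).
      by rewrite subrr mulr0.
    by move=> j _; rewrite !mxE.
  rewrite !mem_cat => /orP[/mapP[j _ ->]|]; first by rewrite c1E l0.
  rewrite !inE => /or3P[/orP[]/eqP->|/mapP[i _ ->]|/mapP[i _ ->]];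
    by rewrite ?oppE ?c2w ?c3w ?oppr0.
exists (fun j => w (inr j)).
have wl t : w (inl t) = u (inl t).
  by rewrite wu //; apply/mapP => -[].
have eq0 c : c \in L -> opp c \in L -> lineval c n w = 0.
  move=> /H h1 /H; rewrite oppE oppr_ge0 => h2.
  by apply/eqP; rewrite eq_le h1 h2.
split=> [j||].
- rewrite -c1E; apply: H; rewrite mem_cat map_f ?mem_enum //.
- have : lineval c2 n w = 0.
    by apply: eq0; rewrite !mem_cat !inE eqxx ?orbT.
  by rewrite c2E wl => /eqP; rewrite subr_eq0 => /eqP.
apply/colP => i; rewrite summxE.
have : lineval (c3 i) n w = 0.
  by apply: eq0; rewrite !mem_cat (map_f c3, map_f (fun i => opp (c3 i)))
    ?mem_enum ?orbT.
rewrite c3E wl => /eqP; rewrite mulf_eq0 gt_eqF //= subr_eq0 => /eqP ->.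
by apply: eq_bigr => j _; rewrite !mxE.
Qed.

(** Inserting [g] into each of the finitely many half-space forms and multiplying by the common
    denominator gives a polynomial in $n$, whose sign is eventually constant. *)
Lemma near_convex_hull_dec (g : nat -> 'cV[R]_d) :
  (forall i, ratl (fun n => g n i 0)) ->
  (\forall n \near \oo, convex_hull (range (F^~ n)) (g n)) \/
  (\forall n \near \oo, ~ convex_hull (range (F^~ n)) (g n)).
Proof.
move=> /common_denominator[D [A DA]]; have [L HL] := convex_hull_halfspaces.
pose q (p : aff) := p.1 * D + \sum_i p.2 i * A i.
have qE : \forall n \near \oo, forall p,
    (0 <= affeval p n (g n)) = (0 <= peval (q p) n).
  apply: filterS DA => n [D0 gE] p.
  rewrite -(pmulr_rge0 _ D0); congr (0 <= _).
  rewrite /affeval pevalD pevalM peval_sum mulrDr mulrC mulr_sumr.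
  congr (_ + _); apply: eq_bigr => i _; rewrite gE pevalM; field.
  exact: lt0r_neq0.
have [/allP Lq|] := boolP (all (fun p => 0 <= lead_coef (q p)) L).
  left; have Lq' : \forall n \near \oo, forall p, p \in L -> 0 <= peval (q p) n.
    apply: near_all_seq => p /Lq; rewrite le_eqVlt => /orP[|/near_peval_gt0].
      rewrite eq_sym lead_coef_eq0 => /eqP ->.
      by apply: nearW => n; rewrite peval0.
    by apply: filterS => n; exact: ltW.
  by apply: filterS3 HL qE Lq' => n HL qE Lq'; apply/HL => p /Lq'; rewrite qE.
move=> /allPn[p pL]; rewrite -ltNge => /near_peval_lt0 q0; right.
apply: filterS3 HL qE q0 => n HL qE q0 /HL/(_ p pL).
by rewrite qE leNgt q0.
Qed.

End Hull.
End RationalFamilies.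

(** * Signs of polynomial forms at integral points *)

Section Discretization.
Variable d : nat.

Definition intform := ('rV[int]_d * int * int)%type.

Definition intform_eval (l : intform) (n : nat) (x : 'cV[int]_d) : int :=
  \sum_i l.1.1 0 i * x i 0 + l.1.2 * n%:Z + l.2.

Definition polyform_eval (p : aff d) (n : nat) (x : 'cV[int]_d) : int :=
  p.1.[n%:Z] + \sum_i (p.2 i).[n%:Z] * x i 0.

Definition in_box (K n : nat) (x : 'cV[int]_d) := forall i, `|x i 0| <= (K * n)%:Z.

Definition same_signs (L : seq intform) n x y := forall l, l \in L ->
  sgz (intform_eval l n x) = sgz (intform_eval l n y).

Lemma same_signs_cat L1 L2 n x y : same_signs (L1 ++ L2) n x y ->
  same_signs L1 n x y /\ same_signs L2 n x y.
Proof. by move=> H; split=> l lL; apply: H; rewrite mem_cat lL ?orbT. Qed.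

Lemma same_signs_flatten (I : eqType) (s : seq I) (f : I -> seq intform) n x y i :
  same_signs (flatten (map f s)) n x y -> i \in s -> same_signs (f i) n x y.
Proof. by move=> H si l lf; apply: H; apply/flatten_mapP; exists i. Qed.

Lemma norm_horner_le (p : {poly int}) e n : (size p <= e.+1)%N ->
  `|p.[n.+1%:Z]| <= (\sum_(k < size p) `|p`_k|) * n.+1%:Z ^+ e.
Proof.
move=> pe; rewrite horner_coef (le_trans (ler_norm_sum _ _ _)) // mulr_suml.
apply: ler_sum => k _; rewrite normrM ler_wpM2l //.
rewrite normrX ger0_norm // ler_weXn2l //.
by rewrite -ltnS (leq_trans (ltn_ord k)).
Qed.

Lemma horner_take (p : {poly int}) e x : (size p <= e.+1)%N ->
  p.[x] = (take_poly e p).[x] + p`_e * x ^+ e.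
Proof.
move=> pe; rewrite -[in LHS](poly_take_drop e p) hornerD hornerM hornerXn.
congr (_ + _ * _); rewrite (_ : drop_poly e p = (p`_e)%:P) ?hornerC //.
apply/polyP => i; rewrite coef_drop_poly coefC; case: i => [|i] //=.
by rewrite nth_default // (leq_trans pe) // addSn ltnS leq_addl.
Qed.

Lemma sgz_dominant (a r N C : int) : 1 <= N -> `|r| <= C * N -> C < `|a| ->
  sgz (N * a + r) = sgz a.
Proof.
move=> N1; rewrite ler_norml => /andP[r1 r2].
case: (ltrgt0P a) => a0 Ca.
- by rewrite !gtr0_sgz //; nia.
- by rewrite !ltr0_sgz //; nia.
- have C0 : C * N < 0 by nia.
  lia.
Qed.

(* The coefficient of the highest power of n is an integral form l. If |l| is
   large it decides the sign; otherwise l takes one of finitely many values t,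
   and replacing l by t lowers the degree. *)
Lemma polyform_sign_determined (K e : nat) (p : aff d) :
    (size p.1 <= e.+2)%N -> (forall i, size (p.2 i) <= e.+1)%N ->
  exists L : seq intform, forall n x y, (0 < n)%N ->
    in_box K n x -> in_box K n y -> same_signs L n x y ->
    sgz (polyform_eval p n x) = sgz (polyform_eval p n y).
Proof.
(* The constant coefficient may have one degree more than the others because $x$ itself has size
   $O(n)$. For [e] equal to 0 the form is already integral. *)
elim: e p => [|e IH] p sc sA.
  exists [:: (\row_i (p.2 i)`_0, p.1`_1, p.1`_0)].
  move=> n x y _ _ _ /(_ _ (mem_head _ _)).
  have E z : polyform_eval p n z =
      intform_eval (\row_i (p.2 i)`_0, p.1`_1, p.1`_0) n z.
    rewrite /polyform_eval /intform_eval /=.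
    rewrite (horner_coef_wide _ sc) big_ord_recl big_ord1 /= expr0 mulr1 expr1.
    rewrite addrC -[RHS]addrA [X in _ = _ + X]addrC; congr (_ + _).
    apply: eq_bigr => i _; rewrite mxE (horner_coef_wide _ (sA i)) big_ord1.
    by rewrite expr0 mulr1.
  by rewrite !E.
(* At parameter $N$ one has $p = N^{e+1} l + q_0$, and $q_t$ is $p$ with $l$ replaced by the
   constant $t$. *)
pose l : intform := (\row_i (p.2 i)`_e.+1, p.1`_e.+2, p.1`_e.+1).
pose q t : aff d := (take_poly e.+1 p.1 + t *: 'X^(e.+1),
  [ffun i => take_poly e.+1 (p.2 i)]).
have /choice[Lt HLt] t : exists L : seq intform, forall n x y, (0 < n)%N ->
    in_box K n x -> in_box K n y -> same_signs L n x y ->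
    sgz (polyform_eval (q t) n x) = sgz (polyform_eval (q t) n y).
  apply: IH => /= [|i]; last by rewrite ffunE size_take_poly.
  rewrite (leq_trans (size_polyD _ _)) // geq_max; apply/andP; split.
    by rewrite (leq_trans (size_take_poly _ _)).
  by rewrite (leq_trans (size_scale_leq _ _)) // size_polyXn.
pose S (r : {poly int}) : int := \sum_(k < size r) `|r`_k|.
(* On the box $|q_0| \le C N^{e+1}$, so $l$ decides the sign of $p$ once $|l| > C$; [ts] lists the
   integers of $[-C, C]$. *)
pose C : int := S (q 0).1 + \sum_i S ((q 0).2 i) * K%:Z.
have S0 r : 0 <= S r by apply: sumr_ge0.
have C0 : 0 <= C by rewrite addr_ge0 // sumr_ge0 // => i _; rewrite mulr_ge0.
pose ts : seq int := [seq k%:Z - C | k <- iota 0 (`|C|.*2.+1)].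
have tsP (t : int) : `|t| <= C -> t \in ts.
  move=> tC; apply/mapP; exists `|(t + C)%R|%N; last by lia.
  by rewrite mem_iota; lia.
(* The sign of $l - t$ tells whether $l = t$, in which case [Lt t] decides the sign of $p = q_t$;
   the value $t = 0$ yields the sign of $l$ itself for the case of large $l$. *)
exists ([seq (l.1, l.2 - t) | t <- ts] ++ flatten [seq Lt t | t <- ts]).
move=> [//|n] x y _ xK yK /same_signs_cat[s1 s2].
set N := n.+1 in xK yK s1 s2 *.
have fE z : polyform_eval p N z =
    N%:Z ^+ e.+1 * intform_eval l N z + polyform_eval (q 0) N z.
  rewrite /polyform_eval /intform_eval /= scale0r addr0.
  rewrite (horner_take _ sc) /=.
  rewrite (@horner_take (take_poly e.+2 p.1) e.+1) ?size_take_poly //.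
  rewrite coef_take_poly ltnSn.
  have -> : take_poly e.+1 (take_poly e.+2 p.1) = take_poly e.+1 p.1.
    apply/polyP => i; rewrite !coef_take_poly; case: ltnP => // ie.
    by rewrite ltnS (ltnW ie).
  under eq_bigr => i _ do rewrite (horner_take _ (sA i)) mulrDl.
  rewrite big_split /=.
  have -> : \sum_i (p.2 i)`_e.+1 * N%:Z ^+ e.+1 * z i 0 =
      N%:Z ^+ e.+1 * \sum_i (\row_i (p.2 i)`_e.+1) 0 i * z i 0.
    by rewrite mulr_sumr; apply: eq_bigr => i _; rewrite mxE; ring.
  have -> : \sum_i ([ffun i => take_poly e.+1 (p.2 i)] i).[N%:Z] * z i 0 =
      \sum_i (take_poly e.+1 (p.2 i)).[N%:Z] * z i 0.
    by apply: eq_bigr => i _; rewrite ffunE.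
  by rewrite [N%:Z ^+ e.+2]exprS; ring.
have qE t z : polyform_eval (q t) N z = t * N%:Z ^+ e.+1 + polyform_eval (q 0) N z.
  rewrite /polyform_eval /= scale0r addr0 hornerD hornerZ hornerXn; ring.
have small z : in_box K N z -> `|polyform_eval (q 0) N z| <= C * N%:Z ^+ e.+1.
  move=> zK; rewrite /polyform_eval (le_trans (ler_normD _ _)) // mulrDl.
  apply: lerD.
    apply: norm_horner_le; rewrite /= scale0r addr0.
    by rewrite (leq_trans (size_take_poly _ _)).
  rewrite (le_trans (ler_norm_sum _ _ _)) // mulr_suml; apply: ler_sum => i _.
  rewrite normrM exprSr; apply: (@le_trans _ _ 
    (S ((q 0).2 i) * N%:Z ^+ e * (K * N)%:Z)).
    apply: ler_pM => //; apply: norm_horner_le.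
    by rewrite /= ffunE size_take_poly.
  by rewrite PoszM le_eqVlt; apply/orP; left; apply/eqP; ring.
have step t z w : `|t| <= C -> in_box K N z -> in_box K N w ->
    same_signs (Lt t) N z w ->
    sgz (intform_eval (l.1, l.2 - t) N z) = sgz (intform_eval (l.1, l.2 - t) N w) ->
    intform_eval l N z = t -> sgz (polyform_eval p N z) = sgz (polyform_eval p N w).
  move=> tC zK wK zw zw' zt.
  have subE v : intform_eval (l.1, l.2 - t) N v = intform_eval l N v - t.
    by rewrite /intform_eval /= !addrA.
  have wt : intform_eval l N w = t.
    by move/eqP: zw'; rewrite !subE zt subrr sgz0 eq_sym sgz_eq0 subr_eq0 => /eqP.
  have E v : intform_eval l N v = t ->
      polyform_eval p N v = polyform_eval (q t) N v.
    by rewrite fE (qE t) => ->; rewrite mulrC.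
  by rewrite !E //; apply: HLt.
have s1' t : t \in ts -> sgz (intform_eval (l.1, l.2 - t) N x) =
    sgz (intform_eval (l.1, l.2 - t) N y).
  by move=> tt; apply: s1; apply/mapP; exists t.
have [xC|xC] := lerP `|intform_eval l N x| C.
  apply: step (erefl _) => //; last exact/s1'/tsP.
  by apply: same_signs_flatten s2 _; exact: tsP.
have [yC|yC] := lerP `|intform_eval l N y| C.
  apply/esym; apply: step (erefl _) => //; last exact/esym/s1'/tsP.
  by move=> l' /(same_signs_flatten s2 (tsP _ yC)) ->.
have N1 : 1 <= N%:Z ^+ e.+1 by rewrite exprn_ege1.
rewrite !fE !(sgz_dominant N1 (small _ _)) //.
have := s1' 0 (tsP 0 _); rewrite normr0 C0 => /(_ isT).
by rewrite subr0 -surjective_pairing.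
Qed.

Lemma polyforms_sign_determined (K : nat) (P : seq (aff d)) :
  exists L : seq intform, forall n x y, (0 < n)%N ->
    in_box K n x -> in_box K n y -> same_signs L n x y ->
    forall p, p \in P -> sgz (polyform_eval p n x) = sgz (polyform_eval p n y).
Proof.
elim: P => [|p P [L HL]]; first by exists [::].
pose e := (size p.1 + \sum_i size (p.2 i))%N.
have [||Lp HLp] := @polyform_sign_determined K e p.
- by rewrite /e; lia.
- by move=> i; rewrite /e (bigD1 i) //=; lia.
exists (Lp ++ L) => n x y n0 xK yK /same_signs_cat[s1 s2] q.
by rewrite in_cons => /orP[/eqP->|]; [exact: HLp|exact: HL].
Qed.

End Discretization.

(** * Extreme integral points *)

Section ExtremePoints.
Variable d : nat.
Implicit Types (L : seq (intform d)) (x y z : 'cV[int]_d).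

Definition intform_lin (l : intform d) z : int := \sum_i l.1.1 0 i * z i 0.

Lemma intform_evalD (l : intform d) n x z :
  intform_eval l n (x + z) = intform_eval l n x + intform_lin l z.
Proof.
rewrite /intform_eval /intform_lin.
under eq_bigr => i _ do rewrite mxE mulrDr.
by rewrite big_split /=; ring.
Qed.

Lemma intform_linN (l : intform d) z : intform_lin l (- z) = - intform_lin l z.
Proof. by rewrite -sumrN; apply: eq_bigr => i _; rewrite mxE mulrN. Qed.

(** Without full column rank there is a nonzero rational kernel vector; the product of the
    denominators of its entries makes it integral. *)
Lemma integral_kernel m (B : 'M[int]_(m, d)) :
  ~~ row_full (map_mx intr B : 'M[rat]_(m, d)) ->
  exists2 z : 'cV[int]_d, z != 0 & B *m z = 0.
Proof.
set Bq := map_mx _ _ => nfull.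
have : kermx Bq^T != 0 by rewrite kermx_eq0 -row_leq_rank mxrank_tr col_leq_rank.
move=> /rowV0Pn[v /sub_kermxP vB v0].
have Bv : Bq *m v^T = 0 by rewrite -[Bq]trmxK -trmx_mul vB trmx0.
pose D := \prod_j denq (v 0 j).
pose z : 'cV[int]_d := \col_j (numq (v 0 j) * \prod_(k | k != j) denq (v 0 k)).
have zE : map_mx intr z = D%:~R *: v^T.
  apply/colP => j; rewrite !mxE rmorphM /= numqE.
  rewrite /D [in RHS](bigD1 j) //= [in RHS]rmorphM /=.
  ring.
have D0 : (D%:~R : rat) != 0.
  by rewrite intr_eq0; apply/prodf_neq0 => j _; exact: denq_neq0.
exists z.
  apply: contraNneq v0 => z0; move: zE; rewrite z0 map_mx0 => /esym/eqP.
  rewrite scalemx_eq0 (negbTE D0) /= => /eqP vT0.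
  by rewrite -[v]trmxK vT0 trmx0.
apply/matrixP => i j.
have /matrixP/(_ i j) : map_mx intr (B *m z) = 0 :> 'cV[rat]_m.
  by rewrite map_mxM zE -scalemxAr Bv scaler0.
by rewrite !mxE => /eqP; rewrite intr_eq0 => /eqP.
Qed.

Lemma sgz_perturb (a b : int) (M : nat) :
  `|b| <= M%:Z -> M%:Z < `|a| -> sgz (a + b) = sgz a.
Proof.
rewrite ler_norml => /andP[b1 b2].
case: (ltrgt0P a) => a0 Ma.
- by rewrite !gtr0_sgz //; lia.
- by rewrite !ltr0_sgz //; lia.
- by lia.
Qed.

(* Let T be the set of forms of L that are small at an extreme point x. If they
   had a common integral kernel vector z, then x + z and x - z would have the
   same signs as x and x would be their midpoint. So x is determined by the
   values of the forms in T, of which there are finitely many. *)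
Lemma extreme_candidates (K : nat) L :
  exists W : seq ('cV[rat]_d * 'cV[rat]_d), \forall n \near \oo,
    forall (S : set 'cV[int]_d) x, (forall y, S y -> in_box K n y) ->
      (forall y z, in_box K.+1 n y -> in_box K.+1 n z -> same_signs L n y z ->
         S y -> S z) ->
      S x -> (forall z, S (x + z) -> S (x - z) -> z = 0) ->
      exists2 w, w \in W & map_mx intr x = n%:R *: w.1 + w.2.
Proof.
pose m := size L; pose l (i : 'I_m) := tnth (in_tuple L) i.
(* Rows outside [T] are set to zero, so that all subsets share one matrix size. *)
pose B (T : {set 'I_m}) : 'M[int]_(m, d) :=
  \matrix_(i, j) if i \in T then (l i).1.1 0 j else 0.
pose Bq T : 'M[rat]_(m, d) := map_mx intr (B T).
have /choice[Mt HMt] T : exists M : nat, row_full (Bq T) \/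
    exists z, [/\ z != 0, forall i, i \in T -> intform_lin (l i) z = 0,
      forall i, `|intform_lin (l i) z| <= M%:Z & forall j, `|z j 0| <= M%:Z].
  have [?|/integral_kernel[z z0 Bz]] := boolP (row_full (Bq T)).
    by exists 0%N; left.
  exists (\sum_i `|intform_lin (l i) z| + \sum_j `|(z j 0)%R|)%N; right; exists z.
  split=> // [i iT|i|j].
  - have /matrixP/(_ i 0) := Bz; rewrite !mxE => zB; rewrite -[RHS]zB.
    by apply: eq_bigr => j _; rewrite mxE iT.
  - rewrite (bigD1 i) //=; lia.
  - rewrite [X in (_ + X)%N](bigD1 j) //=; lia.
(* One threshold for all subsets: a form of absolute value above [M] at $x$ keeps its sign when $x$
   moves by a chosen kernel vector or its opposite. *)
pose M := (\sum_T Mt T)%N.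
have MtM T : (Mt T <= M)%N by rewrite /M (bigD1 T) //= leq_addr.
(* If the forms in [T] take the values $s_i - M$ at $x$, then $B_T x = n a_T + b_{T,s}$; at full
   rank [pinvmx] is a left inverse of $B_T$ and recovers $x$. *)
pose a (T : {set 'I_m}) : 'cV[rat]_m :=
  \col_i if i \in T then - ((l i).1.2)%:~R else 0.
pose b (T : {set 'I_m}) (s : {ffun 'I_m -> 'I_(M.*2.+1)}) : 'cV[rat]_m :=
  \col_i if i \in T then ((s i)%:Z - M%:Z - (l i).2)%:~R else 0.
exists [seq (pinvmx (Bq T) *m a T, pinvmx (Bq T) *m b T s) |
  T <- enum {set 'I_m}, s <- enum {ffun 'I_m -> 'I_(M.*2.+1)}].
(* The bound $n \ge M$ keeps $x + z$ and $x - z$ in the box of [K.+1]. *)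
apply: filterS (nbhs_infty_ge M) => n Mn S x SK Ssg Sx xext.
pose T := [set i | `|intform_eval (l i) n x| <= M%:Z]%SET.
have [full|[z [z0 zT zl zj]]] := HMt T; last first.
  have xK := SK _ Sx; have zM j : `|z j 0| <= M%:Z.
    by apply: le_trans (zj j) _; rewrite lez_nat.
  have ok z' : (z' = z \/ z' = - z) -> S (x + z').
    move=> z'E; apply: Ssg Sx => [j|j|l' l'L].
    - by apply: le_trans (xK j) _; rewrite lez_nat leq_mul2r leqnSn orbT.
    - have : `|z' j 0| <= M%:Z by case: z'E => ->; rewrite ?mxE ?normrN.
      move=> z'M; rewrite mxE (le_trans (ler_normD _ _)) // mulSn addnC PoszD.
      by rewrite lerD // (le_trans z'M) // lez_nat.
    have [i ->] : exists i, l' = l i by apply/(tnthP (in_tuple L)).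
    have z'l : intform_lin (l i) z' = intform_lin (l i) z \/
        intform_lin (l i) z' = - intform_lin (l i) z.
      by case: z'E => ->; [left|right; rewrite intform_linN].
    rewrite intform_evalD; have [iT|] := boolP (i \in T).
      by case: z'l => ->; rewrite zT ?oppr0 // addr0.
    rewrite inE -ltNge => /sgz_perturb -> //.
    apply: (@le_trans _ _ (Mt T)%:Z); last by rewrite lez_nat.
    by case: z'l => ->; rewrite ?normrN.
  by have /eqP := xext z (ok z (or_introl erefl)) (ok (- z) (or_intror erefl));
    rewrite (negbTE z0).
pose s : {ffun 'I_m -> 'I_(M.*2.+1)} :=
  [ffun i => inord `|(intform_eval (l i) n x + M%:Z)%R|%N].
exists (pinvmx (Bq T) *m a T, pinvmx (Bq T) *m b T s).
  by apply: allpairs_f; rewrite mem_enum.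
rewrite /= scalemxAr -mulmxDr -[LHS]mul1mx -(mulVpmx full) -mulmxA.
congr (_ *m _); rewrite -map_mxM; apply/colP => i; rewrite !mxE.
case: ifP => iT; last first.
  by rewrite big1 ?mulr0 ?addr0 // => j _; rewrite !mxE iT mul0r.
have := iT; rewrite inE => iM.
have -> : (s i)%:Z = intform_eval (l i) n x + M%:Z.
  rewrite ffunE inordK; [lia|].
  move: iM; set e := intform_eval _ _ _; lia.
rewrite -[n%:R]/(n%:~R) -rmorphN -rmorphM -rmorphD /=; congr (_%:~R).
rewrite (eq_bigr (fun j => (l i).1.1 0 j * x j 0)).
  by rewrite /intform_eval; ring.
by move=> j _; rewrite !mxE iT.
Qed.

End ExtremePoints.

(** * Vertices of the integer hull *)

Section Candidates.
Variables (R : realType) (d : nat).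
Local Notation V := 'cV[R]_d.

Lemma integer_pointsP (x : V) :
  integer_points x <-> exists y : 'cV[int]_d, x = map_mx intr y.
Proof.
split=> [/mxOverP xint|[y ->]]; last by apply/mxOverP => i j; rewrite mxE.
exists (\col_i Num.floor (x i 0)); apply/colP => i; rewrite !mxE.
by apply/esym/eqP; rewrite -intrEfloor.
Qed.

Lemma finite_integer_points_box (K : nat) (A : set V) :
  A `<=` @integer_points R d -> (forall x, A x -> forall i, `|x i 0| <= K%:R) ->
  finite_set A.
Proof.
move=> Aint AK.
pose f (s : {ffun 'I_d -> 'I_(K.*2.+1)}) : V := \col_i ((s i)%:Z - K%:Z)%:~R.
apply: (@sub_finite_set _ _ (range f)); last first.
  by apply: finite_image; exact: finite_finset.
move=> x Ax; have /integer_pointsP[y xE] := Aint _ Ax.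
have yK i : `|y i 0| <= K%:Z.
  by have := AK _ Ax i; rewrite xE mxE -intr_norm -[K%:R]/(K%:~R) ler_int.
exists [ffun i => inord `|(y i 0 + K%:Z)%R|%N] => //.
apply/colP => i; rewrite xE !mxE ffunE inordK.
  by congr (_%:~R); have := yK i; move: (y i 0) => a; lia.
by have := yK i; move: (y i 0) => a; lia.
Qed.

Definition linpt (w : 'cV[rat]_d * 'cV[rat]_d) (m : int) : V :=
  map_mx ratr (m%:~R *: w.1 + w.2).

Lemma linptE w m i : linpt w m i 0 = ratr (m%:~R * w.1 i 0 + w.2 i 0).
Proof. by rewrite !mxE. Qed.

Lemma ratl_linpt w i : ratl (fun n => linpt w n%:Z i 0).
Proof.
exists ((numq (w.1 i 0) * denq (w.2 i 0)) *: 'X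
        + (numq (w.2 i 0) * denq (w.1 i 0))%:P),
  (denq (w.1 i 0) * denq (w.2 i 0))%:P; split.
  by rewrite polyC_eq0 mulf_neq0 ?denq_neq0.
apply: nearW => n; rewrite linptE pevalC pevalD pevalC /peval.
rewrite hornerZ hornerX.
have da : ((denq (w.1 i 0))%:~R : R) != 0 by rewrite intr_eq0 denq_neq0.
have db : ((denq (w.2 i 0))%:~R : R) != 0 by rewrite intr_eq0 denq_neq0.
rewrite rmorphD rmorphM /= ratr_int !rmorphM /= /ratr.
by field; rewrite da db.
Qed.

(** Two different affine functions of $n$ agree for at most one $n$. *)
Lemma near_linpt_neq w w' : w != w' ->
  \forall n \near \oo, linpt w n%:Z != linpt w' n%:Z.
Proof.
move=> ww'; have [[n0 E0]|nE] :=
    pselect (exists n : nat, linpt w n%:Z = linpt w' n%:Z); last first.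
  by apply: nearW => n; apply/eqP => E; apply: nE; exists n.
apply: filterS (nbhs_infty_ge n0.+1) => n n0n; apply: contraNneq ww' => E.
have e (m : nat) i : linpt w m%:Z = linpt w' m%:Z ->
    m%:R * w.1 i 0 + w.2 i 0 = m%:R * w'.1 i 0 + w'.2 i 0.
  by move=> /colP/(_ i); rewrite !linptE => /fmorph_inj.
have w1 i : w.1 i 0 = w'.1 i 0.
  have n0n' : (n%:R - n0%:R : rat) != 0.
    by rewrite subr_eq0 eqr_nat gtn_eqF.
  apply: (mulfI n0n'); move: (e _ i E0) (e _ i E); lra.
rewrite -pair_eqE /pair_eq /=; apply/andP; split; apply/eqP/colP => i //.
by have := e _ i E; rewrite w1 => /addrI.
Qed.

Variables (J : finType) (F : J -> nat -> V).
Hypothesis ratF : forall j i, ratl (fun n => F j n i 0).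
Variable K : nat.
Hypothesis boundF : \forall n \near \oo, forall j i, `|F j n i 0| <= (K * n)%:R.

Let P n := range (F^~ n).

Lemma convex_hull_bound : \forall n \near \oo, forall x,
  convex_hull (P n) x -> forall i, `|x i 0| <= (K * n)%:R.
Proof.
apply: filterS boundF => n bF; apply: convex_hull_box => _ [j _ <-]; exact: bF.
Qed.

(** A bounded hull contains only finitely many integral points, so [krein_milman_seq] applies to
    them. *)
Lemma integer_hull_krein_milman : \forall n \near \oo,
  @integer_points R d `&` convex_hull (P n)
    `<=` convex_hull (vertices (integer_hull (P n))).
Proof.
apply: filterS convex_hull_bound => n bP.
have /finite_seqP[s sE] :
    finite_set (@integer_points R d `&` convex_hull (P n)).
  apply: (@finite_integer_points_box (K * n)) => [x []//|x [_ /bP]]; exact.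
by rewrite /integer_hull sE; exact: krein_milman_seq.
Qed.

(** [extreme_candidates] is applied to the set of integral points of the hull. By the half-space
    description, membership inside the box depends only on the signs of finitely many integral
    forms, and a vertex that is the midpoint of $x + z$ and $x - z$ in this set forces $z = 0$. *)
Lemma integer_hull_candidates : exists W : seq ('cV[rat]_d * 'cV[rat]_d),
  \forall n \near \oo, forall x, vertices (integer_hull (P n)) x ->
    exists2 w, w \in W & x = linpt w n%:Z.
Proof.
have [L1 HL1] := convex_hull_halfspaces ratF.
have [L HL] := polyforms_sign_determined K.+1 L1.
have [W HW] := extreme_candidates K L; exists W.
apply: filterS3 HL1 convex_hull_bound (filterI HW (nbhs_infty_ge 1)).
move=> n {}HL1 bP [{}HW n0] x vx.
have [/integer_pointsP[y xE] Px] := vertices_sub vx.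
pose toV (z : 'cV[int]_d) : V := map_mx intr z.
pose S := [set z | convex_hull (P n) (toV z)].
have affE p z : affeval p n (toV z) = (polyform_eval p n z)%:~R.
  rewrite /affeval /polyform_eval rmorphD rmorph_sum; congr (_ + _).
  by apply: eq_bigr => i _; rewrite mxE rmorphM.
have [z Sz i||||w wW yE] := HW S y.
- by have := bP _ Sz i; rewrite mxE -intr_norm pmulrn ler_int.
- move=> z1 z2 z1K z2K sg /HL1 Sz1; apply/HL1 => p pL.
  have := HL _ _ _ n0 z1K z2K sg _ pL; have := Sz1 _ pL.
  rewrite !affE !ler0z => + /esym sgE.
  by rewrite -[in X in _ -> X]sgz_ge0 sgE sgz_ge0.
- by rewrite /S /= /toV -xE.
- move=> z Sp Sm; have hull z' : S z' -> integer_hull (P n) (toV z').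
    move=> Sz'; apply: sub_convex_hull; split=> //.
    by apply/integer_pointsP; exists z'.
  have [||e _] := vx.2 _ _ 2^-1 (hull _ Sp) (hull _ Sm).
  + by rewrite invr_gt0 ltr0n /= invf_lt1 ?ltr1n.
  + apply/colP => i; rewrite xE !mxE !rmorphD /= rmorphN /=; by field.
  apply/colP => i; move/colP: e => /(_ i); rewrite xE !mxE => /eqP.
  by rewrite eqr_int -[X in _ == X]addr0 => /eqP/addrI.
exists w => //; rewrite xE; apply/colP => i; rewrite linptE mxE.
have /colP/(_ i) := yE; rewrite !mxE => /(congr1 (@ratr R)); rewrite ratr_int => ->.
by [].
Qed.

End Candidates.

(** * Vertices along a residue class *)

Section Residue.
Variables (R : realType) (d : nat).
Local Notation pair := ('cV[rat]_d * 'cV[rat]_d)%type.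

Definition linpts (s : seq pair) (n : nat) : set 'cV[R]_d :=
  [set linpt R w n%:Z | w in [set` s]].

Lemma linpts_range (s : seq pair) n :
  range (fun w : seq_sub s => linpt R (val w) n%:Z) = linpts s n.
Proof.
apply/seteqP; split=> [_ [w _ <-]|_ [w ws <-]].
  by exists (val w); rewrite //= (valP w).
by exists (SeqSub ws).
Qed.

Lemma near_linpts_dec (s : seq pair) (w : pair) :
  (\forall n \near \oo, convex_hull (linpts s n) (linpt R w n%:Z)) \/
  (\forall n \near \oo, ~ convex_hull (linpts s n) (linpt R w n%:Z)).
Proof.
have := @near_convex_hull_dec R d (seq_sub s) (fun v n => linpt R (val v) n%:Z)
  (fun v => ratl_linpt R (val v)) _ (ratl_linpt R w).
by under [X in X \/ _]eq_near do rewrite linpts_range;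
  under [X in _ \/ X]eq_near do rewrite linpts_range.
Qed.

(** Links the families indexed by naturals to the integer index of [QIQ]: for $n \ge N + |i|$ the
    index is a natural number at least $N$. *)
Lemma near_affine_index (per : nat) (i : int) (Q : nat -> Prop) : (0 < per)%N ->
  (\forall m \near \oo, Q m) ->
  \forall n \near \oo, exists2 m : nat, m%:Z = per%:Z * n%:Z + i & Q m.
Proof.
move=> per0 [N _ NQ]; exists (N + `|i|)%N => // n /= Nn.
exists `|(per%:Z * n%:Z + i)%R|%N; first by nia.
by apply: NQ => /=; nia.
Qed.

Lemma common_multiple (s : seq rat) :
  exists2 per : nat, (0 < per)%N & forall q, q \in s -> per%:R * q \is a Num.int.
Proof.
elim: s => [|q s [per per0 IH]]; first by exists 1%N.
exists (per * `|denq q|)%N => [|q'].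
  by rewrite muln_gt0 per0 absz_gt0 denq_neq0.
have dE : (`|denq q|%N%:R : rat) = (denq q)%:~R.
  by rewrite pmulrn gez0_abs // ltW // denq_gt0.
rewrite natrM in_cons dE => /orP[/eqP ->|/IH q's].
  by rewrite -mulrA [_ * q]mulrC -numqE rpredM ?intr_int ?natr_int //.
by rewrite mulrAC rpredM ?intr_int // ?IH.
Qed.

Variables (J : finType) (F : J -> nat -> 'cV[R]_d).
Hypothesis ratF : forall j i, ratl (fun n => F j n i 0).
Variable K : nat.
Hypothesis boundF : \forall n \near \oo, forall j i, `|F j n i 0| <= (K * n)%:R.

Let P n := range (F^~ n).

(** With $\pi$ for [per] and $m = \pi n + r$, a candidate $m a + b$ equals $n(\pi a) + (r a + b)$
    with $\pi a$ integral, so its integrality depends on $r$ alone. Its membership in the hull, or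
    in the hull of other candidates, is eventually constant, so the same candidates are the vertices
    for all large $n$. *)
Lemma integer_hull_residue (W : seq pair) (per : nat) (r : int) :
    (0 < per)%N ->
    (forall w i, w \in W -> per%:R * w.1 i 0 \is a Num.int) ->
    (\forall n \near \oo, forall x, vertices (integer_hull (P n)) x ->
       exists2 w, w \in W & x = linpt R w n%:Z) ->
  exists (m : nat) (M : 'M[{poly int}]_(d, m)), \forall n \near \oo,
    exists2 m : nat, m%:Z = per%:Z * n%:Z + r &
      vertices (integer_hull (P m)) = columns_at M n.
Proof.
move=> per0 Wint HW.
pose intw (w : pair) := [forall i, r%:~R * w.1 i 0 + w.2 i 0 \is a Num.int].
pose inw (w : pair) :=
  `[< \forall n \near \oo, convex_hull (P n) (linpt R w n%:Z) >].
(* [C] collects the candidates that eventually are integral points of the hull. They include all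
   vertices, hence span the integer hull, and [X] selects those outside the hull of the others. *)
pose C := [seq w <- W | intw w && inw w].
pose D w := [seq w' <- C | w' != w].
pose ext w := `[< \forall n \near \oo,
  ~ convex_hull (linpts (D w) n) (linpt R w n%:Z) >].
pose X := [seq w <- C | ext w].
have CW w : w \in C -> w \in W by rewrite mem_filter => /andP[].
(* For [w] in [X] both rational numbers are integers, so [numq] merely changes their type. *)
pose M : 'M[{poly int}]_(d, size X) := \matrix_(i, j)
  (let w := tnth (in_tuple X) j in
   numq (per%:R * w.1 i 0) *: 'X + (numq (r%:~R * w.1 i 0 + w.2 i 0))%:P).
exists (size X), M.
have near_in : \forall n \near \oo, forall w, w \in W ->
    if inw w then convex_hull (P n) (linpt R w n%:Z)
    else ~ convex_hull (P n) (linpt R w n%:Z).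
  apply: near_all_seq => w _; rewrite /inw; case: asboolP => //.
  by case: (near_convex_hull_dec ratF (ratl_linpt R w)).
have near_ext : \forall n \near \oo, forall w, w \in C ->
    if ext w then ~ convex_hull (linpts (D w) n) (linpt R w n%:Z)
    else convex_hull (linpts (D w) n) (linpt R w n%:Z).
  apply: near_all_seq => w _; rewrite /ext; case: asboolP => //.
  by case: (near_linpts_dec (D w) w).
have near_neq : \forall n \near \oo, forall w, w \in W -> forall w', w' \in W ->
    w != w' -> linpt R w n%:Z != linpt R w' n%:Z.
  apply: near_all_seq => w _; apply: near_all_seq => w' _.
  have [->|ww'] := eqVneq w w'; first by apply: nearW => n; rewrite eqxx.
  by apply: filterS (near_linpt_neq R ww') => n.
have km := integer_hull_krein_milman boundF.
apply: filterS (near_affine_index r per0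
  (filterI (filterI HW km) (filterI near_in (filterI near_ext near_neq)))).
move=> n [m mE [[{}HW {}km] [{}near_in [{}near_ext {}near_neq]]]].
exists m => //.
have splitE (w : pair) i : m%:~R * w.1 i 0 + w.2 i 0 =
    n%:R * (per%:R * w.1 i 0) + (r%:~R * w.1 i 0 + w.2 i 0).
  by rewrite mE rmorphD rmorphM /=; ring.
have intwP w : w \in W -> integer_points (linpt R w m%:Z) <-> intw w.
  move=> wW; split=> [/mxOverP wint|/forallP wint].
    apply/forallP => i; have := wint i 0; rewrite linptE splitE.
    move=> /intrP[c]; rewrite -[in RHS]ratr_int => /fmorph_inj cE.
    by rewrite -(addKr (n%:R * (per%:R * w.1 i 0)) (_ + _)) cE rpredD ?rpredN
      ?intr_int // rpredM ?natr_int // Wint.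
  apply/mxOverP => i j; rewrite ord1 linptE splitE.
  have /intrP[c ->] :
      n%:R * (per%:R * w.1 i 0) + (r%:~R * w.1 i 0 + w.2 i 0) \is a Num.int.
    by rewrite rpredD // rpredM ?rpred_nat // Wint.
  by rewrite ratr_int.
have vC x : vertices (integer_hull (P m)) x -> linpts C m x.
  move=> vx; have [w wW xE] := HW x vx; exists w => //=.
  have [xint Px] := vertices_sub vx.
  rewrite mem_filter wW andbT; apply/andP; split; first by apply/intwP; rewrite -?xE.
  by have := near_in w wW; case: ifP => // _; rewrite -xE.
have CS : linpts C m `<=` @integer_points R d `&` convex_hull (P m).
  move=> _ [w /= wC <-]; move: (wC); rewrite mem_filter => /andP[/andP[wi win] wW].
  by split; [apply/intwP|have := near_in w wW; rewrite win].
have -> : integer_hull (P m) = convex_hull (linpts C m).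
  apply/seteqP; split; apply: convex_hull_le.
    apply: (subset_trans km); apply: convex_hull_le => x /vC.
    exact: sub_convex_hull.
  by apply: (subset_trans CS); exact: sub_convex_hull.
(* Different candidates give different points at this [m], so removing the point of [w] removes no
   other candidate. *)
have CD w : w \in C -> linpts C m `\ linpt R w m%:Z = linpts (D w) m.
  move=> wC; apply/seteqP; split=> [y [[w' /= w'C <-] /= ne]|y [w' /=]].
    exists w' => //=; rewrite mem_filter w'C andbT; apply: contra_notN ne => /eqP ->.
    by [].
  rewrite mem_filter => /andP[ne w'C] <-; split; first by exists w'.
  by apply/eqP; apply: near_neq => //; exact: CW.
have colE j : col j (map_mx (fun p : {poly int} => p.[n%:Z]%:~R) M) =
    linpt R (tnth (in_tuple X) j) m%:Z.
  have : tnth (in_tuple X) j \in X by exact: mem_tnth.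
  set w := tnth _ _ => wX.
  have [wC _] : w \in C /\ ext w by move: wX; rewrite mem_filter => /andP[].
  have wi : intw w by move: wC; rewrite mem_filter => /andP[/andP[]].
  apply/colP => i; rewrite linptE splitE !mxE -/w hornerD hornerZ hornerX hornerC.
  rewrite -{2}(numqK (Wint _ i (CW _ wC))) -{2}(numqK (forallP wi i)).
  by rewrite -[n%:R]/(n%:~R) -rmorphM -rmorphD ratr_int mulrC.
apply/seteqP; split=> [x /vertices_convex_hullP[[w /= wC <-]]|_ [j ->]].
  rewrite CD // => nC; have wX : w \in X.
    by rewrite mem_filter wC andbT; have := near_ext w wC; case: ifP.
  have [j wE] : exists j, w = tnth (in_tuple X) j by apply/(tnthP (in_tuple X)).
  by exists j; rewrite colE wE.
rewrite colE; apply/vertices_convex_hullP.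
have : tnth (in_tuple X) j \in X by exact: mem_tnth.
rewrite mem_filter; set w := tnth _ _ => /andP[we wC].
split; first by exists w.
by rewrite CD //; have := near_ext w wC; rewrite we.
Qed.

End Residue.

(** * From rational functions to the quasi-polynomial vertices *)

Lemma ratl_fraceval (R : realType) (f : {fraction {poly rat}}) :
  ratl (fun n => ratr (fraceval f n%:Z%:~R) : R).
Proof.
have den0 : (repr f).2 != 0 by exact: denom_ratioP.
rewrite /fraceval; have [q1 [a1 a10 e1]] := rat_poly_scale (repr f).1.
have [q2 [a2 a20 e2]] := rat_poly_scale (repr f).2.
(* Numerator and denominator are $q_1 / a_1$ and $q_2 / a_2$ with integral $q_i$. The resulting
   identity also holds at roots of the denominator, where both quotients are 0 by convention. *)
exists (a2 *: q1), (a1 *: q2); split.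
  rewrite -size_poly_eq0 size_scale // size_poly_eq0; apply: contraNneq den0 => q20.
  by rewrite e2 q20 rmorph0 scaler0.
apply: nearW => n; rewrite e1 e2 /peval !hornerZ !horner_map /=.
rewrite fmorph_div /= !rmorphM /= !fmorphV /= !ratr_int !invfM invrK.
by ring.
Qed.

Theorem theorem3p5 (R : realType) (d k : nat) (d_ge1 : (1 <= d)%N)
    (k_ge1 : (1 <= k)%N) (v : 'I_k -> 'cV[{fraction {poly rat}}]_d)
    (v_O : forall (i : 'I_k) (j : 'I_d),
       (fun n : nat => ratvec R (v i) n%:Z j 0 : R^o)
         =O_\oo (fun n : nat => n%:R : R^o)) :
  QIQ (fun n : int => integer_hull [set ratvec R (v i) n | i in [set: 'I_k]]).
Proof.
pose F i (n : nat) := ratvec R (v i) n%:Z.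
have ratF i j : ratl (fun n => F i n j 0).
  have [A [B [B0 AB]]] := ratl_fraceval R (v i j 0).
  by exists A, B; split=> //; apply: filterS AB => n; rewrite /F /ratvec mxE.
have [K boundF] : exists K : nat,
    \forall n \near \oo, forall i j, `|F i n j 0| <= (K * n)%:R.
  have /choice[Kf HK] (ij : 'I_k * 'I_d) : exists K : nat,
      \forall n \near \oo, `|F ij.1 n ij.2 0| <= (K * n)%:R.
    have /eqO_exP[c [c0 Hc]] := v_O ij.1 ij.2.
    exists (Num.bound c); apply: filterS Hc => n /= /le_trans; apply.
    rewrite natrM ger0_norm // ler_wpM2r // ltW //.
    by apply: le_lt_trans (archi_boundP (ltW c0)).
  exists (\sum_ij Kf ij)%N.
  have {}HK : \forall n \near \oo, forall ij, `|F ij.1 n ij.2 0| <= (Kf ij * n)%:R.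
    exact: filter_forall HK.
  apply: filterS HK => n HK i j; apply: le_trans (HK (i, j)) _.
  by rewrite ler_nat leq_mul2r (bigD1 (i, j)) //= leq_addr orbT.
have [W HW] := integer_hull_candidates ratF boundF.
(* The period clears the denominators of the slopes in $n$ of all candidates. *)
have [per per0 perP] := common_multiple
  [seq w.1 i 0 | w : 'cV[rat]_d * 'cV[rat]_d <- W, i <- enum 'I_d].
exists per => // r.
have [|m [M HM]] := integer_hull_residue ratF boundF r per0 _ HW.
  by move=> w i wW; apply: perP; apply: allpairs_f; rewrite // mem_enum.
exists m, M; apply: filterS HM => n [p pE <-].
by rewrite -pE.
Qed.
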